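(* Let $c_1,\dots,c_s$ be distinct real parameters, let $T>0$, let $\{u_k\}_{k=1}^s$ be a set of sufficiently smooth, linearly independent basis functions satisfying the collocation condition for FRKN methods, and consider the problem $y''(t)=f(t,y(t))$ with $f:\mathbb{R}\times\mathbb{R}\to\mathbb{R}$ sufficiently smooth and Lipschitz continuous in $y$. Then the $s$-stage FRKN method with respect to $\{u_k\}_{k=1}^s$ has order of accuracy $p=s$ and stage order $r=s$.
   Context: Notation: $\boldsymbol{c}=(c_1,\dots,c_s)^T$, $\boldsymbol{e}=(1,\dots,1)^T\in\mathbb{R}^s$; scalar functions are applied componentwise to vectors, and $f(\boldsymbol{e}t+\boldsymbol{c}h,\boldsymbol{Y})=(f(t+c_1h,Y_1),\dots,f(t+c_sh,Y_s))^T$. The integration interval is $[t_0,t_0+T]$. The basis $\{u_k\}$ does not include $1$ or $t$. FRKN method: the coefficients $\boldsymbol{A}(t,h)\in\mathbb{R}^{s\times s}$, $\boldsymbol{b}(t,h),\boldsymbol{d}(t,h)\in\mathbb{R}^s$ are determined by the relations, for all $k=1,\dots,s$, $$u_k(t+h)=u_k(t)+hu_k'(t)+h^2\boldsymbol{b}(t,h)^Tu_k''(\boldsymbol{e}t+\boldsymbol{c}h),$$ $$u_k'(t+h)=u_k'(t)+h\,\boldsymbol{d}(t,h)^Tu_k''(\boldsymbol{e}t+\boldsymbol{c}h),$$ $$u_k(\boldsymbol{e}t+\boldsymbol{c}h)=\boldsymbol{e}u_k(t)+h\boldsymbol{c}u_k'(t)+h^2\boldsymbol{A}(t,h)u_k''(\boldsymbol{e}t+\boldsymbol{c}h).$$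 One step of size $h$ from $(t_n,y_n,y_n')$ is, with $t_{n+1}=t_n+h$ and coefficients evaluated at $(t_n,h)$, $$\boldsymbol{Y}_n=\boldsymbol{e}y_n+\boldsymbol{c}hy_n'+h^2\boldsymbol{A}f(\boldsymbol{e}t_n+\boldsymbol{c}h,\boldsymbol{Y}_n),$$ $$y_{n+1}=y_n+hy_n'+h^2\boldsymbol{b}^Tf(\boldsymbol{e}t_n+\boldsymbol{c}h,\boldsymbol{Y}_n),\qquad y_{n+1}'=y_n'+h\,\boldsymbol{d}^Tf(\boldsymbol{e}t_n+\boldsymbol{c}h,\boldsymbol{Y}_n).$$ Collocation condition for FRKN methods: for any given $t$, the $s\times s$ matrices $\boldsymbol{E}(t,h)$, with $(i,k)$ entry $u_k(t+c_ih)-u_k(t)-c_ihu_k'(t)$, and $\boldsymbol{F}(t,h)$, with $(i,k)$ entry $u_k''(t+c_ih)$, are both nonsingular for almost every $h\in[0,T]$. Order: let $y(t)$ be the exact solution of $y''=f(t,y)$ with $y(t_n)=y_n$, $y'(t_n)=y_n'$, and suppose that (as $h\to0$) $$y(t_{n+1})-y_{n+1}=O(h^{p_1+1}),\quad y'(t_{n+1})-y_{n+1}'=O(h^{p_2+1}),\quad \boldsymbol{Y}_n-y(\boldsymbol{e}t_n+\boldsymbol{c}h)=O(h^{p_3+1}).$$ Then the (global) order of accuracy is $p=\min\{p_1,p_2\}$ and the (global) stage order is $r=\min\{p_1,p_2,p_3\}$. These are upper-bound estimates: the statement that the method has order $p$ (stage order $r$) means that such estimates hold, not that they cannot be improved for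 particular $(c_i)$.
   Formalization: Order s and stage order s are asserted only at those t_n in the interval where the Wronskian of u_1'',...,u_s'' is nonzero, a set shown to be dense; at other t_n the claim can fail (s=1, c_1=1, u_1=t^3, f=1, t_n=0). *)

(* Defs.v *)
From HB Require Import structures.
From mathcomp Require Import all_boot all_order all_algebra.
From mathcomp Require Import all_classical all_reals all_analysis.

Set Implicit Arguments.
Unset Strict Implicit.
Unset Printing Implicit Defensive.
Import Order.TTheory GRing.Theory Num.Theory.
Import numFieldNormedType.Exports.

Local Open Scope ring_scope.
Local Open Scope classical_set_scope.

Definition Ck (R : realType) (n : nat) (g : R -> R) : Prop :=
  (forall j x, (j < n)%N -> derivable (g^`(j)) x 1) /\ continuous (g^`(n)).

(* [f] is [C^(n+1)] on the plane iff it is differentiable with [C^n] partial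
   derivatives. *)
Fixpoint Ck2 (R : realType) (n : nat) (f : R * R -> R) : Prop :=
  match n with
  | 0 => continuous f
  | m.+1 => [/\ forall p, differentiable f p,
                Ck2 m (fun p => 'D_(1, 0) f p)
              & Ck2 m (fun p => 'D_(0, 1) f p)]
  end.

Definition linearly_independent (R : realType) (s : nat) (u : 'I_s -> R -> R) :
    Prop :=
  forall a : 'I_s -> R,
    (forall t, \sum_k a k * u k t = 0) -> forall k, a k = 0.

Section FRKN.
Variables (R : realType) (s : nat) (c : 'cV[R]_s) (u : 'I_s -> R -> R).

Definition nodes (t h : R) : 'cV[R]_s := const_mx t + h *: c.

Definition collocE (t h : R) : 'M[R]_s :=
  \matrix_(i, k) (u k (nodes t h i 0) - u k t - c i 0 * h * (u k)^`()%classic t).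

Definition collocF (t h : R) : 'M[R]_s :=
  \matrix_(i, k) (u k)^`(2)%classic (nodes t h i 0).

Definition collocation_condition (t0 T : R) : Prop :=
  forall t, t0 <= t <= t0 + T ->
    {ae lebesgue_measure, forall h : R, 0 <= h <= T ->
       collocE t h \in unitmx /\ collocF t h \in unitmx}.

Definition frkn_coefficients (t h : R) (A : 'M[R]_s) (b d : 'cV[R]_s) : Prop :=
  forall k, let u2 : 'cV[R]_s := map_mx (u k)^`(2)%classic (nodes t h) in
  [/\ u k (t + h) = u k t + h * (u k)^`()%classic t + h ^+ 2 * (b^T *m u2) 0 0,
      (u k)^`()%classic (t + h) = (u k)^`()%classic t + h * (d^T *m u2) 0 0
    & map_mx (u k) (nodes t h) =
        const_mx (u k t) + (h * (u k)^`()%classic t) *: c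
          + h ^+ 2 *: (A *m u2)].

(* One step of size [h] from [(t, y0, y0')], with stage values [Y] and result
   [(y1, y1')]; the stage equation is implicit, hence a relation. *)
Definition frkn_step (f : R -> R -> R) (t h y0 y0' : R)
    (Y : 'cV[R]_s) (y1 y1' : R) : Prop :=
  exists A b d, frkn_coefficients t h A b d /\
    let fY : 'cV[R]_s := map2_mx f (nodes t h) Y in
    [/\ Y = const_mx y0 + (h * y0') *: c + h ^+ 2 *: (A *m fY),
        y1 = y0 + h * y0' + h ^+ 2 * (b^T *m fY) 0 0
      & y1' = y0' + h * (d^T *m fY) 0 0].

Definition exact_solution_near (f : R -> R -> R) (tn : R) (y : R -> R) : Prop :=
  \forall t \near tn,
    [/\ derivable y t 1, derivable (y^`()%classic) t 1
      & y^`(2)%classic t = f t (y t)].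

(* The first conjunct under [\near] says that the method is well defined for
   all small step sizes, so that the error bounds are not vacuous. *)
Definition local_error_exponents (f : R -> R -> R) (tn : R) (p1 p2 p3 : nat) :
    Prop :=
  forall y : R -> R, exact_solution_near f tn y ->
  exists C : R, \forall h \near 0^'+,
    (exists Y y1 y1', frkn_step f tn h (y tn) (y^`()%classic tn) Y y1 y1') /\
    (forall Y y1 y1', frkn_step f tn h (y tn) (y^`()%classic tn) Y y1 y1' ->
      [/\ `|y (tn + h) - y1| <= C * h ^+ p1.+1,
          `|y^`()%classic (tn + h) - y1'| <= C * h ^+ p2.+1
        & forall i, `|Y i 0 - y (nodes tn h i 0)| <= C * h ^+ p3.+1]).

Definition order_of_accuracy (f : R -> R -> R) (D : set R) (p : nat) : Prop :=
  exists p1 p2 p3, p = minn p1 p2 /\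
    forall tn, D tn -> local_error_exponents f tn p1 p2 p3.

Definition stage_order (f : R -> R -> R) (D : set R) (r : nat) : Prop :=
  exists p1 p2 p3, r = minn (minn p1 p2) p3 /\
    forall tn, D tn -> local_error_exponents f tn p1 p2 p3.

(* The points where the Wronskian of [u_1'', ..., u_s''], equivalently that of
   [1, t, u_1, ..., u_s], does not vanish.  The order may drop elsewhere: for
   [s = 1], [u t = t ^+ 3], [c = 1] and [y'' = 1], the collocation condition
   holds on [0, T], but a step of size [h] from [t = 0] gives
   [y1' = y0' + h / 2]. *)
Definition regular_points (t0 T : R) : set R :=
  [set t | t0 <= t <= t0 + T /\
           \det (\matrix_(i < s, k < s) (u k)^`(i.+2)%classic t) != 0].

End FRKN.

(* Main.v *)
Require Import Defs.
From HB Require Import structures.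
From mathcomp Require Import all_boot all_order all_algebra.
From mathcomp Require Import all_classical all_reals all_analysis.
From mathcomp Require Import ring lra.
Import Order.TTheory GRing.Theory Num.Theory.
Import numFieldNormedType.Exports.
Local Open Scope ring_scope.
Local Open Scope classical_set_scope.

Set Implicit Arguments.
Unset Strict Implicit.
Unset Printing Implicit Defensive.

(** Each relation that defines the coefficients says that a remainder of [u_k]
    (the Taylor remainder of the position at a node or at the end of the step,
    or the increment of the velocity) equals a power of [h] times a weighted sum
    of second derivatives at the nodes.  Such remainders are linear, hence the
    rules are exact on all combinations of the basis functions.

    At a point [a] where the Wronskian of the second derivatives is nonzero, a
    combination of the basis functions can be chosen whose second derivative has
    any prescribed Taylor polynomial of degree less than [s] at [a].  This is
    used twice.

    Prescribing the monomials [(x - a) ^+ j] shows that the weights have, after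
    rescaling by [h ^+ j], almost prescribed Vandermonde moments at the distinct
    abscissae [c_i].  Hence for small [h] the collocation matrix is invertible
    and the weights are bounded independently of [h], although the inverse of
    that matrix need not be ([weights_bound], [collocF_unit_near],
    [exact_weights_bounded]).

    Prescribing the Taylor polynomial of the second derivative of the exact
    solution, which is smooth enough by a bootstrap through the equation
    ([smooth_ode]), leaves a difference that is [O(h ^+ s)] at the nodes; so the
    rules have an error [O(h ^+ s.+1)] for the velocity and [O(h ^+ s.+2)] for
    the positions and stages ([exact_weights_consistent]).  The implicit stage
    equation is a contraction with a factor [O(h ^+ 2)], which yields existence
    of the step and absorbs the propagated stage error ([frkn_local_error]).

    The points so treated are dense in the interval: if the Wronskian vanished on
    an open interval, the second derivatives would be linearly dependent on a
    subinterval ([wronskian0_dependent]), and the collocation matrix would be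
    singular for all small steps from a point in it, a set of positive measure
    ([regular_points_dense]). *)

(** * Local growth, Taylor expansion and smoothness *)

Section LocalCalculus.
Variable R : realType.
Implicit Types (g w : R -> R) (a x h C : R) (n m : nat).

(** [g x = O((x - a) ^ n)] at [a].  The constant is kept as a witness because
    bounds for finitely many functions have to be merged into one constant,
    chosen before the step size. *)
Definition flat n a g : Prop :=
  exists2 C, 0 <= C & \forall x \near a, `|g x| <= C * `|x - a| ^+ n.

Definition derives_near a w g := \forall x \near a, is_derive (x : R) 1 w (g x).

Lemma flatD n a g w : flat n a g -> flat n a w -> flat n a (fun x => g x + w x).
Proof.
move=> [C C0 gC] [D D0 wD]; exists (C + D); first exact: addr_ge0.
near=> x; rewrite (le_trans (ler_normD _ _))// mulrDl lerD//; near: x => //.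
Unshelve. all: by end_near. Qed.

Lemma flatZ n a k g : flat n a g -> flat n a (fun x => k * g x).
Proof.
move=> [C C0 gC]; exists (`|k| * C); first exact: mulr_ge0.
by near=> x; rewrite normrM -mulrA ler_wpM2l//; near: x.
Unshelve. all: by end_near. Qed.

Lemma flat_eq n a g w : g =1 w -> flat n a g -> flat n a w.
Proof. by move=> /funext ->. Qed.

Lemma flatB n a g w : flat n a g -> flat n a w -> flat n a (fun x => g x - w x).
Proof.
move=> fg fw; apply: (flat_eq (g := fun x => g x + (-1) * w x)).
  by move=> x; rewrite mulN1r.
exact/flatD/flatZ.
Qed.

Lemma flat0 n a : flat n a (fun=> 0).
Proof. by exists 0 => //; near=> x; rewrite normr0 mul0r.
Unshelve. all: by end_near. Qed.

Lemma flat_sum n a (I : finType) (g : I -> R -> R) :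
  (forall i, flat n a (g i)) -> flat n a (fun x => \sum_i g i x).
Proof.
move=> fg; elim: (index_enum I) => [|i r ih].
  by apply: (flat_eq _ (flat0 n a)) => x; rewrite big_nil.
by apply: (flat_eq _ (flatD (fg i) ih)) => x; rewrite big_cons.
Qed.

Lemma dist_lt_near a e : 0 < e -> \forall x \near a, `|x - a| < e.
Proof.
by move=> e0; apply/nbhs_ballP; exists e => //= x; rewrite /ball/= distrC.
Qed.

Lemma flat_le n m a g : (n <= m)%N -> flat m a g -> flat n a g.
Proof.
move=> nm [C C0 gC]; exists C => //.
near=> x; have gx : `|g x| <= C * `|x - a| ^+ m by near: x.
by rewrite (le_trans gx)// ler_wpM2l// ler_wiXn2l.
Unshelve. all: by end_near. Qed.

(** The intermediate point is no farther from [a] than [x] is, so that a bound on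
    [g] in powers of the distance to [a] applies there.  This serves both sides
    of [a]: some nodes may lie behind the starting point of a step. *)
Lemma mean_value_near a w g : derives_near a w g ->
  \forall x \near a,
    exists2 z, `|z - a| <= `|x - a| & w x - w a = g z * (x - a).
Proof.
move=> /nbhs_ballP[e /= e0 dw]; apply/nbhs_ballP; exists e => //= x.
rewrite /ball/= distrC => xe.
have seg z : `|z - a| <= `|x - a| -> is_derive z 1 w (g z).
  by move=> zx; apply: dw; rewrite /ball/= distrC (le_lt_trans zx).
case: (leP a x) => [ax|/ltW xa].
  have zb z : z \in `[a, x]%R -> `|z - a| <= `|x - a|.
    by rewrite in_itv/= => /andP[az zx]; rewrite !ger0_norm ?subr_ge0// lerD2r.
  have [z zax wz] : exists2 z, z \in `[a, x]%R & w x - w a = g z * (x - a).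
    apply: MVT_segment => // [z|].
      by move=> /subset_itv_oo_cc; move=> /zb/seg.
    apply: derivable_within_continuous => z /zb/seg[] //.
  by exists z => //; exact: zb.
have zb z : z \in `[x, a]%R -> `|z - a| <= `|x - a|.
  by rewrite in_itv/= => /andP[az zx]; rewrite !ler0_norm ?subr_le0// lerN2 lerD2r.
have [z zax wz] : exists2 z, z \in `[x, a]%R & w a - w x = g z * (a - x).
  apply: MVT_segment => // [z|].
    by move=> /subset_itv_oo_cc; move=> /zb/seg.
  apply: derivable_within_continuous => z /zb/seg[] //.
by exists z; [exact: zb|rewrite -[LHS]opprB wz -mulrN opprB].
Qed.

Lemma flat_primitive n a w g : derives_near a w g ->
  flat n a g -> flat n.+1 a (fun x => w x - w a).
Proof.
move=> dw [C C0 /nbhs_ballP[e /= e0 gC]]; exists C => //.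
near=> x.
have [z zx ->] : exists2 z, `|z - a| <= `|x - a| & w x - w a = g z * (x - a).
  by near: x; exact: mean_value_near.
rewrite normrM exprSr mulrA ler_wpM2r// (le_trans (gC z _))//.
  by rewrite /ball/= distrC (le_lt_trans zx)//; near: x; exact: dist_lt_near.
by rewrite ler_wpM2l// lerXn2r ?nnegrE.
Unshelve. all: by end_near. Qed.

Definition taylor_poly n a (G : nat -> R -> R) x : R :=
  \sum_(i < n) G i a / i`!%:R * (x - a) ^+ i.

(** Induction on the order: the remainder of [G 0] vanishes at [a] and is a
    primitive of the remainder of [G 1], which is one order lower. *)
Lemma taylor_flat n a (G : nat -> R -> R) :
  (forall i, (i < n)%N -> derives_near a (G i) (G i.+1)) ->
  flat 0 a (G n) -> flat n a (fun x => G 0 x - taylor_poly n a G x).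
Proof.
elim: n G => [|n IHn] G dG fG.
  by apply: flat_eq fG => x; rewrite /taylor_poly big_ord0 subr0.
have {}IHn := IHn (fun i => G i.+1) (fun i => dG i.+1) fG.
pose w x := G 0 x - taylor_poly n.+1 a G x.
have wa : w a = 0.
  rewrite /w /taylor_poly big_ord_recl/= subrr expr0 mulr1 divr1 big1 ?addr0 ?subrr//.
  by move=> i _; rewrite exprS mul0r mulr0.
apply: (@flat_eq _ _ (fun x => w x - w a)) => [x|]; first by rewrite wa subr0.
apply: flat_primitive IHn.
near=> x.
have -> : w = G 0 - (cst (G 0 a) +
    \sum_(i < n) (G i.+1 a / i.+1`!%:R) \*: ((id - cst a) ^+ i.+1)).
  apply/funext => y; rewrite /w /taylor_poly big_ord_recl/= expr0 mulr1 divr1.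
  rewrite !fctE fct_sumE; congr (_ - (_ + _)).
  by apply: eq_bigr => i _; rewrite exprfctE.
have dx : is_derive x 1 (G 0) (G 1 x) by near: x; exact: dG.
apply: is_derive_eq.
rewrite add0r; congr (_ - _); apply: eq_bigr => i _.
rewrite subr0 !/GRing.scale/= mulr1 factS natrM.
by field; rewrite pnatr_eq0 -lt0n fact_gt0 nat1r pnatr_eq0.
Unshelve. all: by end_near. Qed.

(** Differentiability classes at a point are defined by recursion on the
    derivative because the Leibniz and chain rules then close them under
    products and compositions with no formula for higher derivatives. *)
Fixpoint smooth n a g : Prop :=
  match n with
  | 0 => \forall x \near a, {for x, continuous g}
  | m.+1 => exists2 g', derives_near a g g' & smooth m a g'
  end.

Lemma smoothW n a g : smooth n.+1 a g -> smooth n a g.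
Proof.
elim: n g => [|n IHn] g [g' dg].
  move=> _; near=> x; apply: differentiable_continuous.
  by apply/derivable1_diffP; have [] : is_derive x 1 g (g' x) by near: x.
by exists g' => //; exact: IHn.
Unshelve. all: by end_near. Qed.

Lemma smoothD n a g w : smooth n a g -> smooth n a w -> smooth n a (g + w).
Proof.
elim: n g w => [|n IHn] g w /=.
  by move=> cg cw; near=> x; apply: continuousD; near: x.
move=> [g' dg sg] [w' dw sw]; exists (g' + w'); last exact: IHn.
near=> x; have : is_derive x 1 g (g' x) by near: x.
have : is_derive x 1 w (w' x) by near: x.
by move=> ? ?; exact: is_deriveD.
Unshelve. all: by end_near. Qed.

Lemma smoothM n a g w : smooth n a g -> smooth n a w -> smooth n a (g * w).
Proof.
elim: n g w => [|n IHn] g w /=.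
  by move=> cg cw; near=> x; apply: continuousM; near: x.
move=> sg sw; have [g' dg sg'] := sg; have [w' dw sw'] := sw.
exists (g * w' + w * g').
  near=> x; have : is_derive x 1 g (g' x) by near: x.
  have : is_derive x 1 w (w' x) by near: x.
  by move=> ? ?; exact: is_deriveM.
by apply: smoothD; apply: IHn => //; exact: smoothW.
Unshelve. all: by end_near. Qed.

Lemma smooth_taylor n a g : smooth n a g ->
  exists p : nat -> R, flat n a (fun x => g x - \sum_(i < n) p i * (x - a) ^+ i).
Proof.
move=> sg; suff [G [G0 dG cG]] : exists G : nat -> R -> R, [/\ G 0 = g,
    (forall i, (i < n)%N -> derives_near a (G i) (G i.+1))
    & flat 0 a (G n)].
  exists (fun i => G i a / i`!%:R).
  by rewrite -G0; exact: taylor_flat.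
elim: n g sg => [|n IHn] g /=.
  move=> /nbhs_singleton cg; exists (fun=> g); split => //.
  exists (`|g a| + 1); first by rewrite addr_ge0.
  near=> x; rewrite expr0 mulr1; near: x.
  by apply: cvgr_norm_le; [exact: cg|rewrite ltrDl].
move=> [g' dg /IHn[G [G0 dG fG]]].
exists (fun i => if i is j.+1 then G j else g); split => //.
by move=> [_|i]; [rewrite G0|exact: dG].
Unshelve. all: by end_near. Qed.

(** The derivative of [F] is split into its two partial derivatives because these
    are the functions to which the recursive definition of [Ck2] gives access. *)
Lemma is_derive_along_graph (F : R * R -> R) w dw x :
  differentiable F (x, w x) -> is_derive x 1 w dw ->
  is_derive x 1 (fun t => F (t, w t))
    ('D_(1, 0) F (x, w x) + 'D_(0, 1) F (x, w x) * dw).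
Proof.
move=> dF dwx; pose P t := (t, w t).
have dw1 : differentiable w x by apply/derivable1_diffP; case: dwx.
have dP : differentiable P x by exact: differentiable_pair.
have dFP : differentiable (F \o P) x by exact: differentiable_comp.
apply: DeriveDef; first exact/derivable1_diffP.
rewrite deriveE// diff_comp//= diff_pair//= (diff_val (df := id)).
have -> : 'd w x 1 = dw by rewrite -deriveE// derive_val.
rewrite !deriveE//.
have -> : ((1, dw) : R * R) = (1, 0) + dw *: (0, 1).
  apply/eqP; rewrite xpair_eqE/= scaler0 addr0 add0r [_ *: 1]mulr1.
  by rewrite !eqxx.
by rewrite linearD linearZ/= mulrC.
Qed.

Lemma smooth_along_graph n a (F : R * R -> R) w :
  Ck2 n F -> smooth n a w -> smooth n a (fun t => F (t, w t)).
Proof.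
elim: n F w => [|n IHn] F w /=.
  move=> cF cw; near=> x.
  apply: (@continuous_comp _ _ _ (fun t => (t, w t)) F); last exact: cF.
  have cwx : {for x, continuous w} by near: x.
  exact: (cvg_pair (@cvg_id _ (nbhs x)) cwx).
move=> [dF CF1 CF2] sw; have [w' dw sw'] := sw.
have {}sw : smooth n a w by exact: (@smoothW n a w).
exists ((fun t => 'D_(1, 0) F (t, w t)) + (fun t => 'D_(0, 1) F (t, w t)) * w').
  near=> x; have dwx : is_derive x 1 w (w' x) by near: x.
  exact: (is_derive_along_graph (dF _) dwx).
apply: smoothD; first exact: (IHn _ _ CF1 sw).
by apply: smoothM => //; exact: (IHn _ _ CF2 sw).
Unshelve. all: by end_near. Qed.

(** Each differentiation class of [y] passes to the right-hand side and comes
    back two classes higher, until the smoothness of [f] is exhausted. *)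
Lemma smooth_ode n a (f : R -> R -> R) (y y1 : R -> R) :
  Ck2 n (fun p => f p.1 p.2) ->
  derives_near a y y1 ->
  derives_near a y1 (fun t => f t (y t)) ->
  smooth n a (fun t => f t (y t)).
Proof.
move=> Cf dy dy1.
have Ck2W m (F : R * R -> R) : Ck2 m.+1 F -> Ck2 m F.
  elim: m F => [|m IHm] F [dF F1 F2]; first by move=> p; exact: differentiable_continuous.
  by split; [exact: dF|exact: (IHm _ F1)|exact: (IHm _ F2)].
suff : smooth n a y by exact: smooth_along_graph Cf.
elim: n Cf => [_|n IHn Cf].
  by apply: (@smoothW 0); exists y1 => //; near=> x;
     apply: differentiable_continuous; apply/derivable1_diffP;
     have [] : is_derive x 1 y1 (f x (y x)) by near: x.
have sy := IHn (Ck2W _ _ Cf).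
exists y1 => //; apply: smoothW; exists (fun t => f t (y t)) => //.
exact: smooth_along_graph (Ck2W _ _ Cf) sy.
Unshelve. all: by end_near. Qed.

End LocalCalculus.

(** * Vanishing Wronskians *)

Section Wronskian.
Variable R : realType.
Implicit Types (x y a b : R).

Lemma derivable_prod (I : Type) (r : seq I) (F : I -> R -> R) x :
  (forall i, derivable (F i) x 1) ->
  derivable (fun y => \prod_(i <- r) F i y) x 1.
Proof.
move=> dF; elim: r => [|i r ih].
  rewrite (_ : (fun _ => _) = cst 1); first exact: derivable_cst.
  by apply/funext => y; rewrite big_nil.
rewrite (_ : (fun _ => _) = F i * (fun y => \prod_(i <- r) F i y)).
  exact: (derivableM (dF i) ih).
by apply/funext => y; rewrite big_cons.
Qed.

Lemma derivable_bigsum (I : Type) (r : seq I) (F : I -> R -> R) x :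
  (forall i, derivable (F i) x 1) ->
  derivable (fun y => \sum_(i <- r) F i y) x 1.
Proof.
move=> dF; elim: r => [|i r ih].
  rewrite (_ : (fun _ => _) = cst 0); first exact: derivable_cst.
  by apply/funext => y; rewrite big_nil.
rewrite (_ : (fun _ => _) = F i + (fun y => \sum_(i <- r) F i y)).
  exact: (derivableD (dF i) ih).
by apply/funext => y; rewrite big_cons.
Qed.

Lemma derivable_scale (k : R) (w : R -> R) x :
  derivable w x 1 -> derivable (fun y => k * w y) x 1.
Proof.
move=> dw; rewrite (_ : (fun _ => _) = k \*: w); first exact: derivableZ.
exact/funext.
Qed.

Lemma derivable_det n (M : R -> 'M[R]_n) x :
  (forall i j, derivable (fun y => M y i j) x 1) ->
  derivable (fun y => \det (M y)) x 1.
Proof.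
move=> dM; rewrite /determinant; apply: derivable_bigsum => s.
exact/derivable_scale/derivable_prod.
Qed.

Lemma derivable_invmx_entry n (M : R -> 'M[R]_n) x i j :
  (forall k l, derivable (fun y => M y k l) x 1) ->
  \det (M x) != 0 ->
  derivable (fun y => ((\det (M y))^-1 *: \adj (M y)) i j) x 1.
Proof.
move=> dM M0.
rewrite (_ : (fun y => _) =
  (fun y => (\det (M y))^-1) * (fun y => cofactor (M y) j i)); last first.
  by apply/funext => y; rewrite !mxE.
apply: derivableM; first by apply: derivableV => //; exact: derivable_det.
apply/derivable_scale/derivable_det => k l.
by under eq_fun do rewrite !mxE; exact: dM.
Qed.

Lemma cst_of_derive0 (w : R -> R) a b :
  (forall x, x \in `]a, b[%R -> is_derive x 1 w 0) ->
  {in `]a, b[%R &, forall x y, w x = w y}.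
Proof.
move=> dw.
have H x y : x \in `]a, b[%R -> y \in `]a, b[%R -> x <= y -> w x = w y.
  rewrite !in_itv/= => /andP[ax xb] /andP[ay yb] xy.
  have dxy z : z \in `[x, y]%R -> is_derive z 1 w 0.
    rewrite in_itv/= => /andP[xz zy]; apply: dw.
    by rewrite in_itv/= (lt_le_trans ax)//= (le_lt_trans zy).
  have dw0 z : z \in `]x, y[%R -> is_derive z 1 w (cst 0 z).
    by move=> zxy; apply: dxy; exact: subset_itv_oo_cc.
  have cw : {within `[x, y], continuous w}.
    by apply: derivable_within_continuous => z /dxy[].
  have [z _] := MVT_segment xy dw0 cw.
  by rewrite /= mul0r => /eqP; rewrite subr_eq0 => /eqP.
by move=> x y xab yab; have [xy|/ltW yx] := leP x y; [exact: H|apply/esym/H].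
Qed.

(** A family of functions whose Wronskian vanishes on an interval need not be
    dependent on that interval, but it is on some subinterval.  If the Wronskian
    of the family without its first member vanishes identically as well, that
    member is dropped.  Otherwise the smaller Wronskian has no zero on a
    subinterval; there the first member is a combination of the others with
    differentiable coefficients, and these have zero derivatives. *)
Lemma wronskian0_dependent m (v : 'I_m -> nat -> R -> R) a b : a < b ->
  (forall k i x, (i < m)%N -> x \in `]a, b[%R ->
    is_derive x 1 (v k i) (v k i.+1 x)) ->
  (forall x, x \in `]a, b[%R -> \det (\matrix_(i < m, k < m) v k i x) = 0) ->
  exists a' b', [/\ a <= a', a' < b', b' <= b & exists alpha : 'cV[R]_m,
    alpha != 0 /\
    forall x, x \in `]a', b'[%R -> \sum_k alpha k 0 * v k 0%N x = 0].
Proof.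
elim: m v a b => [|m IHm] v a b ab dv W0.
  have : (a + b) / 2 \in `]a, b[%R by rewrite in_itv/= !midf_lt.
  by move=> /W0/eqP; rewrite det_mx00 oner_eq0.
pose w x := \matrix_(i < m, k < m) v (lift ord0 k) i x.
pose r x := \col_(i < m) v ord0 i x.
have dw x i k : x \in `]a, b[%R -> derivable (fun y => w y i k) x 1.
  move=> xab; under eq_fun do rewrite mxE.
  by have [] := dv (lift ord0 k) i x (ltn_trans (ltn_ord i) (ltnSn m)) xab.
have [w0|/existsNP[x0 /not_implyP[x0ab /eqP w0]]] :=
    pselect (forall x, x \in `]a, b[%R -> \det (w x) = 0).
  have [|a' [b' [aa' ab' bb' [alpha [alpha0 H]]]]] :=
      IHm (fun k => v (lift ord0 k)) a b ab _ w0.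
    by move=> k i x im; apply: dv; exact: ltn_trans im _.
  exists a', b'; split => //.
  exists (\col_k oapp (fun j => alpha j 0) 0 (unlift ord0 k)); split.
    apply: contra alpha0 => /eqP al0; apply/eqP/colP => j.
    by have := congr1 (fun M : 'cV_m.+1 => M (lift ord0 j) 0) al0; rewrite !mxE liftK.
  move=> x /H H0; rewrite big_ord_recl mxE unlift_none/= mul0r add0r -[RHS]H0.
  by apply: eq_bigr => k _; rewrite mxE liftK.
have [p [q [ap pq qb wpq]]] : exists p q, [/\ a <= p, p < q, q <= b &
    forall x, x \in `]p, q[%R -> \det (w x) != 0].
  have cw : {for x0, continuous (fun x => \det (w x))}.
    apply/differentiable_continuous/derivable1_diffP/derivable_det => i k.
    exact: dw.
  have /nbhs_ballP[e /= e0 we] : \forall x \near x0, \det (w x) != 0.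
    exact: (@cvgr_neq0 _ _ _ (nbhs x0) _ (fun y => \det (w y)) _ cw w0).
  move: x0ab; rewrite in_itv/= => /andP[ax0 x0b].
  exists (Num.max a (x0 - e)), (Num.min b (x0 + e)); split.
  - by rewrite le_max lexx.
  - by rewrite lt_min !gt_max ab ltrBlDr; apply/and3P; split; lra.
  - by rewrite ge_min lexx.
  - move=> x; rewrite in_itv/= gt_max lt_min => /andP[/andP[_ x1] /andP[_ x2]].
    by apply: we; rewrite /ball/= ltr_distlC; apply/andP; split; lra.
have sub x : x \in `]p, q[%R -> x \in `]a, b[%R.
  by apply: subset_itvSoo; rewrite bnd_simp.
pose c x := ((\det (w x))^-1 *: \adj (w x)) *m r x.
have wc x : x \in `]p, q[%R -> w x *m c x = r x.
  move=> /wpq w1; have wu : w x \in unitmx by rewrite unitmxE unitfE.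
  by rewrite /c; have := mulKVmx wu (r x); rewrite /invmx wu.
(* The last row of the singular (m+1)-matrix gives the same relation between
   the m-th derivatives. *)
have rel x i : x \in `]p, q[%R -> (i <= m)%N ->
    \sum_k v (lift ord0 k) i x * c x k 0 = v ord0 i x.
  move=> xpq im.
  have wu : w x \in unitmx by rewrite unitmxE unitfE wpq.
  have /eqP/det0P[z z0 zW] : \det (\matrix_(i < m.+1, k < m.+1) v k i x)^T = 0.
    by rewrite det_tr W0// sub.
  have zE (j : 'I_m.+1) : z 0 ord0 * v ord0 j x +
      \sum_(k < m) z 0 (lift ord0 k) * v (lift ord0 k) j x = 0.
    have := congr1 (fun M : 'rV_m.+1 => M 0 j) zW; rewrite mxE big_ord_recl !mxE.
    by under eq_bigr do rewrite !mxE.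
  pose z' : 'cV_m := \col_k z 0 (lift ord0 k).
  have wz : w x *m z' = - z 0 ord0 *: r x.
    apply/colP => j; have := zE (widen_ord (leqnSn m) j); rewrite !mxE/= => /eqP.
    rewrite addrC addr_eq0 mulNr => /eqP <-; apply: eq_bigr => k _.
    by rewrite !mxE mulrC.
  have z00 : z 0 ord0 != 0.
    apply: contra z0 => /eqP z00; move: wz; rewrite z00 oppr0 scale0r => wz.
    have z'0 : z' = 0 by rewrite -(mulKmx wu z') wz mulmx0.
    apply/eqP/rowP => j; rewrite mxE; have [k ->|->] := unliftP ord0 j => //.
    by have := congr1 (fun M : 'cV_m => M k 0) z'0; rewrite !mxE.
  have cz : c x = - (z 0 ord0)^-1 *: z'.
    rewrite -(mulKmx wu (c x)) wc// -(mulKmx wu z') wz -!scalemxAr scalerA.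
    by rewrite mulrNN mulVf// scale1r.
  have := zE (Ordinal (im : (i < m.+1)%N)); rewrite /= => /eqP.
  rewrite addr_eq0 => /eqP zv; apply: (mulfI z00); rewrite zv mulr_sumr -sumrN.
  by apply: eq_bigr => k _; rewrite cz !mxE; field.
have dc x k : x \in `]p, q[%R -> derivable (fun y => c y k 0) x 1.
  move=> xpq; under eq_fun do rewrite mxE; apply: derivable_bigsum => j.
  apply: derivableM.
    by apply: derivable_invmx_entry; [move=> *; exact/dw/sub|exact: wpq].
  under eq_fun do rewrite mxE.
  by have [] := dv ord0 j x (ltn_trans (ltn_ord j) (ltnSn m)) (sub _ xpq).
have c0 x k : x \in `]p, q[%R -> is_derive x 1 (fun y => c y k 0) 0.
  move=> xpq; pose dcx := \col_k 'D_1 (fun y => c y k 0) x.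
  suff : dcx = 0.
    move=> /(congr1 (fun M : 'cV_m => M k 0)); rewrite !mxE => <-.
    exact/derivableP/dc.
  (* Differentiating the relation of order [i] and subtracting that of order
     [i.+1] leaves [w x] applied to the derivatives of the coefficients. *)
  have wu : w x \in unitmx by rewrite unitmxE unitfE wpq.
  rewrite -(mulKmx wu dcx) [w x *m dcx](_ : _ = 0) ?mulmx0//.
  apply/colP => i; rewrite mxE [RHS]mxE.
  have im : (i < m.+1)%N by exact: ltn_trans (ltn_ord i) _.
  have := dv ord0 i x im (sub _ xpq).
  have : is_derive x 1 (fun y => \sum_k v (lift ord0 k) i y * c y k 0)
     (\sum_k (v (lift ord0 k) i x *: dcx k 0 +
              c x k 0 *: v (lift ord0 k) i.+1 x)).
    have -> : (fun y => \sum_k v (lift ord0 k) i y * c y k 0) =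
        \sum_k (v (lift ord0 k) i * (fun y => c y k 0)).
      by apply/funext => y; rewrite fct_sumE.
    apply: is_derive_sum => j; apply: is_deriveM; first exact: dv _ (sub _ xpq).
    by rewrite mxE; exact/derivableP/dc.
  move=> d1 d2.
  have d3 : is_derive x 1 (v ord0 i) (\sum_k (v (lift ord0 k) i x *: dcx k 0 +
              c x k 0 *: v (lift ord0 k) i.+1 x)).
    apply: near_eq_is_derive d1.
    have : \forall y \near x, y \in `]p, q[%R by apply: near_in_itvoo.
    by apply: filterS => y ypq; apply: rel => //; exact: ltnW.
  have := derive_val (is_derive := d3); rewrite (derive_val (is_derive := d2)).
  rewrite -(rel x i.+1 xpq (ltn_ord i)) big_split/= => /eqP.
  under [X in _ == _ + X]eq_bigr do rewrite /GRing.scale/= mulrC.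
  rewrite eq_sym -subr_eq0 addrK => /eqP dc0; rewrite -[RHS]dc0.
  by apply: eq_bigr => k' _; rewrite mxE.
pose x1 := (p + q) / 2.
have x1pq : x1 \in `]p, q[%R by rewrite in_itv/= !midf_lt.
exists p, q; split => //.
exists (\col_k oapp (fun j => - c x1 j 0) 1 (unlift ord0 k)); split.
  apply/eqP => /(congr1 (fun M : 'cV_m.+1 => M ord0 0)).
  by rewrite !mxE unlift_none => /eqP; rewrite oner_eq0.
move=> x xpq; rewrite big_ord_recl mxE unlift_none/= mul1r.
rewrite -(rel x 0 xpq (leq0n m)) -big_split/= big1// => k _.
rewrite mxE liftK/=.
have -> : c x1 k 0 = c x k 0 by exact: (cst_of_derive0 (fun z => @c0 z k)).
by rewrite mulNr mulrC subrr.
Qed.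

End Wronskian.

(** * Density of the regular points *)

Section Density.
Variables (R : realType) (s : nat) (c : 'cV[R]_s) (u : 'I_s -> R -> R).

Lemma is_derive_Ck k i (x : R) : (forall k, Ck s.+2 (u k)) -> (i < s.+2)%N ->
  is_derive x 1 ((u k)^`(i)) ((u k)^`(i.+1) x).
Proof.
move=> uC is_; apply: DeriveDef; last by rewrite derive1nS derive1E.
by have [+ _] := uC k; apply.
Qed.

Lemma ae_interval_nonempty (P : set R) (e : R) : 0 < e ->
  {ae lebesgue_measure, forall h : R, P h} -> exists2 h, 0 <= h <= e & P h.
Proof.
move=> e0 [A [mA A0 PA]]; apply: contrapT => noh.
have sub : `[0, e]%classic `<=` A.
  move=> h; rewrite /= in_itv/= => h0e; apply: PA => Ph.
  by apply: noh; exists h.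
have : (lebesgue_measure `[0%R, e]%classic <= lebesgue_measure A)%E.
  by apply: le_measure => //; rewrite inE.
rewrite A0 lebesgue_measure_itv/= lte_fin e0 sube0 lee_fin.
by rewrite leNgt e0.
Qed.

(** Where the Wronskian of the second derivatives vanishes on an interval, these
    derivatives are dependent on a smaller one, and then so are the columns of
    the collocation matrix for every step that keeps the nodes inside. *)
Lemma regular_points_dense (t0 T : R) : 0 < T -> (forall k, Ck s.+2 (u k)) ->
  collocation_condition c u t0 T ->
  [set t | t0 <= t <= t0 + T] `<=` closure (regular_points u t0 T).
Proof.
move=> T0 uC colloc t /= /andP[t0t tT] B /nbhs_ballP[e /= e0 eB].
apply: contrapT => noreg.
pose a := Num.max t0 (t - e); pose b := Num.min (t0 + T) (t + e).
have ab : a < b by rewrite lt_min !gt_max ltrDl T0/=; apply/and3P; split; lra.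
have inab x : x \in `]a, b[%R -> t0 <= x <= t0 + T /\ ball t e x.
  rewrite in_itv/= gt_max lt_min => /andP[/andP[x1 x2] /andP[x3 x4]].
  split; first by rewrite !ltW.
  by rewrite /ball/= ltr_distlC; apply/andP; split; lra.
have [k i x is_ _|x /inab[xT xB]|p [q [ap pq qb [alpha [alpha0 dep]]]]] :=
  @wronskian0_dependent R s (fun k i => (u k)^`(i.+2)) a b ab.
- by apply: is_derive_Ck.
- apply/eqP/negPn/negP => W0; apply: noreg; exists x; split; last exact: eB.
  by split.
have sub x : x \in `]p, q[%R -> x \in `]a, b[%R.
  by apply: subset_itvSoo; rewrite bnd_simp.
(* From the midpoint [tau], steps up to [eta] keep every node in [`]p, q[],
   since [M] exceeds all [`|c i 0|]. *)
pose tau := (p + q) / 2; pose M := 1 + \sum_i `|c i 0|.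
have M0 : 0 < M by rewrite ltr_pwDl// sumr_ge0.
have cM i : `|c i 0| < M.
  by rewrite /M (bigD1 i)//= addrCA ltrDl ltr_pwDl// sumr_ge0.
pose eta := Num.min T ((q - p) / (2 * M)).
have eta0 : 0 < eta by rewrite lt_min T0 divr_gt0 ?subr_gt0// mulr_gt0.
have /inab[tauT _] : tau \in `]a, b[%R by apply: sub; rewrite in_itv/= !midf_lt.
have [h h0eta] := ae_interval_nonempty eta0 (colloc tau tauT).
have /andP[h0 heta] := h0eta.
have [hT hM] : h <= T /\ h <= (q - p) / (2 * M).
  by move: heta; rewrite le_min => /andP[].
rewrite h0 hT => /(_ isT)[_ uF].
have Fa : collocF c u tau h *m alpha = 0.
  apply/colP => i; rewrite !mxE.
  have xi : nodes c tau h i 0 \in `]p, q[%R.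
    have : `|h * c i 0| < (q - p) / 2.
      have [->|hn0] := eqVneq h 0; first by rewrite mul0r normr0; lra.
      have hp : 0 < h by rewrite lt_neqAle eq_sym hn0.
      rewrite normrM (ger0_norm h0) (@lt_le_trans _ _ (h * M))// ?ltr_pM2l//.
      move: hM; rewrite ler_pdivlMr ?mulr_gt0//; lra.
    rewrite ltr_norml /nodes !mxE in_itv/= /tau => /andP[h1 h2].
    by apply/andP; split; lra.
  by rewrite -[RHS](dep _ xi); apply: eq_bigr => k _; rewrite !mxE mulrC.
by move/eqP: alpha0; apply; rewrite -(mulKmx uF alpha) Fa mulmx0.
Qed.

End Density.

(** * Weights with prescribed moments *)

Section Weights.
Variables (R : realType) (s : nat).
Implicit Types (a x h M : R) (w : 'cV[R]_s).

Lemma flat_comp n a k (g : R -> R) :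
  flat n a g -> flat n 0 (fun h => g (a + h * k)).
Proof.
move=> [C C0 /nbhs_ballP[e /= e0 gC]]; exists (C * `|k| ^+ n); first exact: mulr_ge0.
have : \forall h \near (0 : R), `|h - 0| < e / (1 + `|k|).
  by apply: dist_lt_near; rewrite divr_gt0// ltr_pwDl.
apply: filterS => h; rewrite subr0 ltr_pdivlMr ?ltr_pwDl// => he.
rewrite -mulrA -exprMn (le_trans (gC _ _))//.
  rewrite /ball/= opprD addNKr normrN normrM (le_lt_trans _ he)//.
  by rewrite ler_wpM2l// lerDr.
by rewrite addrC addKr normrM [`|k| * _]mulrC.
Qed.

Lemma flat_norm n a (g : R -> R) : flat n a g -> flat n a (fun x => `|g x|).
Proof. by case=> C C0 gC; exists C => //; apply: filterS gC => x; rewrite normr_id. Qed.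

Lemma near_at_right (P : set R) a :
  (\forall h \near a, P h) -> \forall h \near a^'+, P h.
Proof. by move=> aP; apply: cvg_within; exact: aP. Qed.

Lemma flat_at_right n (g : R -> R) : flat n 0 g ->
  exists2 C, 0 <= C & \forall h \near 0^'+, `|g h| <= C * h ^+ n.
Proof.
move=> [C C0 gC]; exists C => //.
apply: filterS2 (near_at_right gC) (nbhs_right_gt 0) => h gh h0.
by move: gh; rewrite subr0 (gtr0_norm h0).
Qed.

Lemma unitmx_l1_bound (V : 'M[R]_s) : V \in unitmx ->
  exists2 K, 0 <= K & forall w M,
    (forall j, `|(V *m w) j 0| <= M) -> \sum_i `|w i 0| <= K * M.
Proof.
move=> Vu; exists (\sum_i \sum_j `|invmx V i j|) => [|w M wM].
  by rewrite sumr_ge0// => i _; rewrite sumr_ge0.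
rewrite mulr_suml ler_sum// => i _; rewrite -{1}(mulKmx Vu w) mxE.
rewrite (le_trans (ler_norm_sum _ _ _))// mulr_suml ler_sum// => j _.
by rewrite normrM ler_wpM2l.
Qed.

Variable c : 'cV[R]_s.
Hypothesis c_inj : injective (fun i => c i 0).

Lemma vandermonde_nodes_unit : Vandermonde s c^T \in unitmx.
Proof.
rewrite unitmxE det_Vandermonde unitfE.
apply/prodf_neq0 => i _; apply/prodf_neq0 => j ij.
by rewrite !mxE subr_eq0 (inj_eq c_inj) gt_eqF.
Qed.

(** Against functions that agree with the monomials [(x - a) ^+ j] up to order
    [s], the values of a weight vector are, after division by [h ^+ j], its
    Vandermonde moments up to a relative error [O(h)], which is absorbed for
    small [h].  With [M = 0] this says that the moments determine the weights,
    and otherwise that the weights are bounded independently of [h]. *)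
Lemma weights_bound a (phi : 'I_s -> R -> R) :
  (forall j : 'I_s, flat s a (fun x => phi j x - (x - a) ^+ j)) ->
  exists2 K, 0 <= K & \forall h \near 0^'+, forall w M,
    (forall j : 'I_s, `|\sum_i w i 0 * phi j (a + h * c i 0)| <= M * h ^+ j) ->
    \sum_i `|w i 0| <= K * M.
Proof.
move=> fphi.
have [K K0 VK] := unitmx_l1_bound vandermonde_nodes_unit.
pose psi h := \sum_i \sum_(j < s)
  `|phi j (a + h * c i 0) - (a + h * c i 0 - a) ^+ j|.
have /flat_at_right[C C0 psiC] : flat s 0 psi.
  apply: flat_sum => i; apply: flat_sum => j; apply: flat_norm.
  exact: (flat_comp (c i 0) (fphi j)).
exists (2 * K); first exact: mulr_ge0.
near=> h => w M wM.
have h0 : 0 < h by [].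
have h1 : h <= 1 by near: h; exact: nbhs_right_le.
(* Half of the norm of [w] can then be absorbed on the left. *)
have hK : h * (K * C) <= 2^-1.
  have : h < 2^-1 / (1 + K * C).
    by near: h; apply: nbhs_right_lt; rewrite divr_gt0// ltr_pwDl// mulr_ge0.
  rewrite ltr_pdivlMr ?ltr_pwDl ?mulr_ge0// mulrDr mulr1 => hlt.
  by apply: ltW; apply: le_lt_trans hlt; rewrite lerDr ltW.
have phih i (j : 'I_s) :
    `|phi j (a + h * c i 0) - (h * c i 0) ^+ j| <= C * h ^+ j.+1.
  apply: (@le_trans _ _ (C * h ^+ s)); last by rewrite ler_wpM2l// ler_wiXn2l// ltW.
  apply: (@le_trans _ _ `|psi h|); last by near: h.
  rewrite [leRHS]ger0_norm; last first.
    by apply: sumr_ge0 => ? _; apply: sumr_ge0.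
  rewrite /psi (bigD1 i)//= (bigD1 j)//= [a + _ - a]addrC addKr -addrA lerDl.
  by apply: addr_ge0; apply: sumr_ge0 => // ? _; exact: sumr_ge0.
pose N' := \sum_i `|w i 0|.
have NE : N' <= K * (M + C * h * N').
  apply: VK => j; rewrite -(@ler_pM2r _ (h ^+ j)) ?exprn_gt0//.
  have -> : `|(Vandermonde s c^T *m w) j 0| * h ^+ j =
      `|\sum_i w i 0 * (h * c i 0) ^+ j|.
    rewrite -[X in _ * X]ger0_norm ?exprn_ge0 ?ltW// -normrM mxE mulr_suml.
    by congr `|_|; apply: eq_bigr => i _; rewrite !mxE exprMn; ring.
  have -> : \sum_i w i 0 * (h * c i 0) ^+ j =
      \sum_i w i 0 * phi j (a + h * c i 0) -
      \sum_i w i 0 * (phi j (a + h * c i 0) - (h * c i 0) ^+ j).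
    by rewrite -sumrB; apply: eq_bigr => i _; ring.
  rewrite (le_trans (ler_normB _ _))// mulrDl lerD//.
  rewrite (le_trans (ler_norm_sum _ _ _))// /N' mulr_sumr mulr_suml ler_sum// => i _.
  rewrite normrM (le_trans (ler_wpM2l _ (phih i j)))// exprS.
  by rewrite le_eqVlt; apply/orP; left; apply/eqP; ring.
have N0 : 0 <= N' by rewrite sumr_ge0.
have := ler_wpM2r N0 hK; rewrite -/N' => H.
by rewrite -mulrA; move: NE; rewrite mulrDr; nra.
Unshelve. all: by end_near. Qed.

End Weights.

(** * Exact weights for remainders *)

Section Remainders.
Variables (R : realType) (s : nat).
Implicit Types (x h : R) (w : 'cV[R]_s) (rem : (R -> R) -> (R -> R) -> R -> R).

Variable a : R.

Definition position_remainder (g : R) : (R -> R) -> (R -> R) -> R -> R :=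
  fun y y1 h => y (a + h * g) - y a - h * g * y1 a.

Definition velocity_remainder : (R -> R) -> (R -> R) -> R -> R :=
  fun y y1 h => y1 (a + h) - y1 a.

(** The three families of relations that define the coefficients have one shape:
    a linear remainder of a function and its derivative is evaluated by a
    weighted sum of second derivatives.  [m] is the number of integrations that
    lead from the second derivative to the remainder. *)
Definition remainder_operator rem m : Prop :=
  [/\ forall (alpha : 'cV[R]_s) (y y1 : 'I_s -> R -> R) h,
        rem (fun x => \sum_k alpha k 0 * y k x)
            (fun x => \sum_k alpha k 0 * y1 k x) h =
        \sum_k alpha k 0 * rem (y k) (y1 k) h,
      forall y y1 z z1 h,
        rem (fun x => y x - z x) (fun x => y1 x - z1 x) h =
        rem y y1 h - rem z z1 h
    & forall n y y1 y2, derives_near a y y1 -> derives_near a y1 y2 ->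
        flat n a y2 -> flat (n + m) 0 (rem y y1)].

Lemma position_remainder_operator g :
  remainder_operator (position_remainder g) 2.
Proof.
split=> [alpha y y1 h|y y1 z z1 h|n y y1 y2 dy dy1 fy2].
- rewrite /position_remainder mulr_sumr -!sumrB.
  by apply: eq_bigr => k _; ring.
- by rewrite /position_remainder; ring.
have fy1 := flat_primitive dy1 fy2.
pose p x := y x - (x - a) * y1 a.
have dp : derives_near a p (fun x => y1 x - y1 a).
  near=> x; have dyx : is_derive x 1 y (y1 x) by near: x.
  rewrite (_ : p = y - ((y1 a) \*: (id - cst a))); last first.
    by apply/funext => z; rewrite /p !fctE /GRing.scale/= mulrC.
  by apply: is_derive_eq; rewrite subr0 /GRing.scale/= mulr1.
have := flat_comp g (flat_primitive dp fy1); rewrite addn2.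
by apply: flat_eq => h; rewrite /position_remainder /p; ring.
Unshelve. all: by end_near. Qed.

Lemma velocity_remainder_operator : remainder_operator velocity_remainder 1.
Proof.
split=> [alpha y y1 h|y y1 z z1 h|n y y1 y2 _ dy1 fy2].
- by rewrite /velocity_remainder -sumrB; apply: eq_bigr => k _; ring.
- by rewrite /velocity_remainder; ring.
have := flat_comp 1 (flat_primitive dy1 fy2); rewrite addn1.
by apply: flat_eq => h; rewrite /velocity_remainder mulr1.
Qed.

Variables (c : 'cV[R]_s) (u : 'I_s -> R -> R).
Hypothesis c_inj : injective (fun i => c i 0).
Hypothesis uC : forall k, Ck s.+2 (u k).
Hypothesis regular : \det (\matrix_(i < s, k < s) (u k)^`(i.+2)%classic a) != 0.

Definition exact_weights rem m h w : Prop := forall k,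
  rem (u k) (u k)^`()%classic h =
  h ^+ m * \sum_i w i 0 * (u k)^`(2)%classic (a + h * c i 0).

Definition combination (alpha : 'cV[R]_s) i x : R :=
  \sum_k alpha k 0 * (u k)^`(i)%classic x.

Lemma combination_derive alpha i : (i < s.+2)%N ->
  derives_near a (combination alpha i) (combination alpha i.+1).
Proof.
move=> is_; near=> x.
rewrite (_ : combination alpha i = \sum_k alpha k 0 \*: (u k)^`(i)%classic); last first.
  by apply/funext => y; rewrite fct_sumE.
apply: is_derive_sum => k.
exact: (is_deriveZ (alpha k 0) (is_derive_Ck k x uC is_)).
Unshelve. all: by end_near. Qed.

(** Regularity of [a] makes every Taylor polynomial of degree less than [s] the
    Taylor polynomial of a combination of the second derivatives. *)
Lemma combination_taylor (p : nat -> R) : exists alpha,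
  flat s a (fun x => combination alpha 2 x - \sum_(i < s) p i * (x - a) ^+ i).
Proof.
pose W := \matrix_(i < s, k < s) (u k)^`(i.+2)%classic a.
have Wu : W \in unitmx by rewrite unitmxE unitfE.
pose q : 'cV[R]_s := \col_i (i`!%:R * p i).
exists (invmx W *m q).
set alpha := invmx W *m q.
have flat0_combination : flat 0 a (combination alpha s.+2).
  apply: flat_sum => k; apply: flatZ; exists (`|(u k)^`(s.+2)%classic a| + 1).
    by rewrite addr_ge0.
  near=> x; rewrite expr0 mulr1; near: x.
  have [_ cu] := uC k.
  by apply: cvgr_norm_le; [exact: cu|rewrite ltrDl].
have dG i : (i < s)%N ->
    derives_near a (combination alpha i.+2) (combination alpha i.+3).
  by move=> is_; apply: combination_derive.
have := taylor_flat (G := fun i => combination alpha i.+2) dG flat0_combination.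
apply: flat_eq => x; congr (_ - _); apply: eq_bigr => i _; congr (_ * _).
have -> : combination alpha i.+2 a = (W *m alpha) i 0.
  by rewrite mxE; apply: eq_bigr => k _; rewrite [W i k]mxE mulrC.
by rewrite /alpha mulKVmx// mxE mulrC mulKf// pnatr_eq0 -lt0n fact_gt0.
Unshelve. all: by end_near. Qed.

Lemma monomial_basis : exists alpha : 'I_s -> 'cV[R]_s, forall j : 'I_s,
  flat s a (fun x => combination (alpha j) 2 x - (x - a) ^+ j).
Proof.
suff /fin_all_exists[alpha fa] (j : 'I_s) : exists alpha : 'cV_s,
    flat s a (fun x => combination alpha 2 x - (x - a) ^+ j) by exists alpha.
have [alpha fa] := combination_taylor (fun i => (i == j)%:R).
exists alpha; apply: flat_eq fa => x; congr (_ - _).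
rewrite (bigD1 j)//= eqxx mul1r big1 ?addr0// => i ij.
by rewrite (_ : (i == j :> nat) = false) ?mul0r//; apply/negbTE.
Qed.

(** A vector in the left kernel of the collocation matrix is a weight vector that
    annihilates the approximate monomials. *)
Lemma collocF_unit_near : \forall h \near 0^'+, collocF c u a h \in unitmx.
Proof.
have [alpha fa] := monomial_basis; have [K _ Kb] := weights_bound c_inj fa.
apply: filterS Kb => h Kb; rewrite unitmxE unitfE; apply/det0P => -[z z0 zF].
have z_sum0 : \sum_i `|z^T i 0| <= K * 0.
  apply: Kb => j; rewrite mul0r normr_le0; apply/eqP.
  have -> : \sum_i z^T i 0 * combination (alpha j) 2 (a + h * c i 0) =
      (z *m collocF c u a h *m alpha j) 0 0.
    rewrite -mulmxA mxE; apply: eq_bigr => i _; rewrite !mxE; congr (_ * _).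
    by apply: eq_bigr => k _; rewrite !mxE mulrC.
  by rewrite zF mul0mx mxE.
move/eqP: z0; apply; apply/rowP => i; rewrite mxE; apply/eqP.
rewrite -normr_le0.
have := z_sum0; rewrite mulr0 (bigD1 i)//= mxE; apply: le_trans.
by rewrite lerDl sumr_ge0.
Qed.

Lemma exact_weights_exist rem m h : h != 0 -> collocF c u a h \in unitmx ->
  exists w, exact_weights rem m h w.
Proof.
move=> h0 Fu.
pose r : 'rV[R]_s := \row_k (h ^- m * rem (u k) (u k)^`()%classic h).
exists (r *m invmx (collocF c u a h))^T => k.
have := congr1 (fun M : 'rV_s => M 0 k) (mulmxKV Fu r); rewrite mxE [RHS]mxE.
move/(congr1 ( *%R (h ^+ m))); rewrite mulrA mulfV ?expf_neq0// mul1r => <-.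
by congr (_ * _); apply: eq_bigr => i _; rewrite !mxE.
Qed.

Lemma exact_weights_combination rem m h w alpha :
  remainder_operator rem m -> exact_weights rem m h w ->
  rem (combination alpha 0) (combination alpha 1) h =
  h ^+ m * \sum_i w i 0 * combination alpha 2 (a + h * c i 0).
Proof.
move=> [lin _ _] wE.
have -> : \sum_i w i 0 * combination alpha 2 (a + h * c i 0) =
    \sum_k alpha k 0 * \sum_i w i 0 * (u k)^`(2)%classic (a + h * c i 0).
  transitivity (\sum_i \sum_k
      w i 0 * (alpha k 0 * (u k)^`(2)%classic (a + h * c i 0))).
    by apply: eq_bigr => i _; rewrite -mulr_sumr.
  rewrite exchange_big; apply: eq_bigr => k _; rewrite mulr_sumr.
  by apply: eq_bigr => i _; exact: mulrCA.
rewrite mulr_sumr; apply: etrans (lin alpha u (fun k => (u k)^`()%classic) h) _.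
by apply: eq_bigr => k _; rewrite wE; exact: mulrCA.
Qed.

(** The inverse of the collocation matrix may blow up as [h] tends to [0], but
    the right-hand sides compensate this: on the approximate monomial of degree [j]
    the remainder is [O(h ^+ (j + m))], which is what [weights_bound] asks for. *)
Lemma exact_weights_bounded rem m : remainder_operator rem m ->
  exists2 K, 0 <= K &
    \forall h \near 0^'+, forall w, exact_weights rem m h w ->
      \sum_i `|w i 0| <= K.
Proof.
move=> remm; have [_ _ remflat] := remm.
have [alpha fa] := monomial_basis; have [K K0 Kb] := weights_bound c_inj fa.
have fflat (j : 'I_s) :
    flat (j + m) 0 (rem (combination (alpha j) 0) (combination (alpha j) 1)).
  apply: remflat (combination_derive _ _) (combination_derive _ _) _ => //.
  apply: (flat_eq (g := fun x => combination (alpha j) 2 x - (x - a) ^+ j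
                                + (x - a) ^+ j)) => [x|].
    by rewrite subrK.
  apply: flatD; first exact: flat_le (ltnW (ltn_ord j)) (fa j).
  by exists 1 => //; near=> x; rewrite mul1r normrX.
have /fin_all_exists[C /all_and2[C0 HC]] (j : 'I_s) :
    exists C, 0 <= C /\ \forall h \near 0^'+,
      `|rem (combination (alpha j) 0) (combination (alpha j) 1) h|
        <= C * h ^+ (j + m).
  by have [C C0 HC] := flat_at_right (fflat j); exists C.
exists (K * \sum_j C j); first by rewrite mulr_ge0// sumr_ge0.
near=> h => w wE.
have h0 : 0 < h by [].
have Kbh : forall w M,
    (forall j : 'I_s, `|\sum_i w i 0 * combination (alpha j) 2 (a + h * c i 0)|
       <= M * h ^+ j) -> \sum_i `|w i 0| <= K * M by near: h.
apply: Kbh => j; rewrite -(@ler_pM2l _ (h ^+ m)) ?exprn_gt0//.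
rewrite -{1}[h ^+ m]ger0_norm ?exprn_ge0 ?(ltW h0)// -normrM.
rewrite -(exact_weights_combination _ remm wE).
have Cj : `|rem (combination (alpha j) 0) (combination (alpha j) 1) h|
    <= C j * h ^+ (j + m) by move: j; near: h; exact: filter_forall.
have -> : h ^+ m * ((\sum_j C j) * h ^+ j) = (\sum_j C j) * h ^+ (j + m).
  by rewrite exprD; ring.
rewrite (le_trans Cj)// ler_wpM2r ?exprn_ge0 ?(ltW h0)//.
by rewrite (bigD1 j)//= lerDl sumr_ge0.
Unshelve. all: by end_near. Qed.

(** Subtract from [y] the combination of the basis functions that interpolates
    its second derivative to order [s]: the weights are exact on the
    combination, and both sides are small on the difference. *)
Lemma exact_weights_consistent rem m (y y1 y2 : R -> R) :
  remainder_operator rem m ->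
  derives_near a y y1 -> derives_near a y1 y2 -> smooth s a y2 ->
  exists2 C, 0 <= C &
    \forall h \near 0^'+, forall w, exact_weights rem m h w ->
      `|rem y y1 h - h ^+ m * \sum_i w i 0 * y2 (a + h * c i 0)|
        <= C * h ^+ (s + m).
Proof.
move=> remm dy dy1 sy2; have [_ remB remflat] := remm.
have [p fp] := smooth_taylor sy2.
have [alpha fa] := combination_taylor p.
pose e i (z : R -> R) x := z x - combination alpha i x.
have de i (z z1 : R -> R) : (i < s.+2)%N -> derives_near a z z1 ->
    derives_near a (e i z) (e i.+1 z1).
  move=> is_ dz; near=> x.
  have : is_derive x 1 z (z1 x) by near: x.
  have : is_derive x 1 (combination alpha i) (combination alpha i.+1 x).
    by near: x; exact: combination_derive.
  by move=> d1 d2; exact: is_deriveB.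
have fe2 : flat s a (e 2 y2).
  by apply: flat_eq (flatB fp fa) => x; rewrite /e; ring.
have [C C0 HC] := flat_at_right (remflat _ _ _ _ (de 0 _ _ isT dy) (de 1 _ _ isT dy1) fe2).
have [K K0 HK] := exact_weights_bounded remm.
have /fin_all_exists[D /all_and2[D0 HD]] (i : 'I_s) :
    exists D, 0 <= D /\ \forall h \near 0^'+,
      `|e 2 y2 (a + h * c i 0)| <= D * h ^+ s.
  by have [D D0 HD] := flat_at_right (flat_comp (c i 0) fe2); exists D.
exists (C + K * \sum_i D i); first by rewrite addr_ge0// mulr_ge0// sumr_ge0.
near=> h => w wE.
have h0 : 0 < h by [].
have Kw : \sum_i `|w i 0| <= K by move: w wE; near: h.
have -> : rem y y1 h - h ^+ m * \sum_i w i 0 * y2 (a + h * c i 0) =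
    rem (e 0 y) (e 1 y1) h - h ^+ m * \sum_i w i 0 * e 2 y2 (a + h * c i 0).
  rewrite remB (exact_weights_combination _ remm wE) /e.
  rewrite -[in RHS]addrA; congr (_ + _); rewrite -opprD -mulrDr -big_split/=.
  by congr (- (_ * _)); apply: eq_bigr => i _; ring.
rewrite (le_trans (ler_normB _ _))// mulrDl lerD//; first by near: h.
rewrite normrM ger0_norm ?exprn_ge0 ?(ltW h0)// exprD mulrA [leRHS]mulrC.
rewrite ler_wpM2l ?exprn_ge0 ?(ltW h0)// (le_trans (ler_norm_sum _ _ _))//.
rewrite -mulrA (le_trans (y := \sum_i `|w i 0| * ((\sum_i D i) * h ^+ s)))//.
  apply: ler_sum => i _; rewrite normrM ler_wpM2l//.
  have : `|e 2 y2 (a + h * c i 0)| <= D i * h ^+ s by move: i; near: h; exact: filter_forall.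
  move=> /le_trans; apply; rewrite ler_wpM2r ?exprn_ge0 ?(ltW h0)//.
  by rewrite (bigD1 i)//= lerDl sumr_ge0.
by rewrite -mulr_suml ler_wpM2r// mulr_ge0 ?exprn_ge0 ?sumr_ge0// (ltW h0).
Unshelve. all: by end_near. Qed.

End Remainders.

(** * The stage equation and the local error *)

(** Stage vectors form a Banach space, as the fixed point theorem requires. *)
HB.instance Definition _ (R : realType) (m n : nat) := Complete.on 'M[R]_(m, n).

Section LocalError.
Variables (R : realType) (s : nat).
Implicit Types (h K L B : R) (w z nd Y Z : 'cV[R]_s) (A : 'M[R]_s).

Lemma mx_entry_le_norm m n (M : 'M[R]_(m, n)) i j : `|M i j| <= `|M|.
Proof.
by rewrite [leRHS]/Num.norm/= mx_normrE; apply/bigmax_geP; right; exists (i, j).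
Qed.

Lemma mx_norm_le m n (M : 'M[R]_(m, n)) B :
  0 <= B -> (forall i j, `|M i j| <= B) -> `|M| <= B.
Proof.
move=> B0 MB; rewrite [leLHS]/Num.norm/= mx_normrE; apply/bigmax_leP.
by split => // -[i j] _; exact: MB.
Qed.

Lemma weighted_sum_le w (g : 'I_s -> R) K B : \sum_i `|w i 0| <= K ->
  0 <= B -> (forall i, `|g i| <= B) -> `|\sum_i w i 0 * g i| <= K * B.
Proof.
move=> wK B0 gB; rewrite (le_trans (ler_norm_sum _ _ _))//.
rewrite (le_trans (y := \sum_i `|w i 0| * B))//; last by rewrite -mulr_suml ler_wpM2r.
by apply: ler_sum => i _; rewrite normrM ler_wpM2l.
Qed.

Variables (f : R -> R -> R) (L : R).
Hypothesis L0 : 0 <= L.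
Hypothesis f_lip : forall t p q : R, `|f t p - f t q| <= L * `|p - q|.

(** The factor [h ^+ 2] makes the stage map a contraction for the maximum norm. *)
Lemma stage_equation_solvable h A z nd K : 0 <= K ->
  (forall i, \sum_j `|(row i A)^T j 0| <= K) -> h ^+ 2 * K * L < 1 ->
  exists Y, Y = z + h ^+ 2 *: (A *m map2_mx f nd Y).
Proof.
move=> K0 AK hK.
pose G Y := z + h ^+ 2 *: (A *m map2_mx f nd Y).
have h2 : 0 <= h ^+ 2 by exact: sqr_ge0.
pose q := NngNum (mulr_ge0 (mulr_ge0 h2 K0) L0).
have qG : is_contraction (totalfun G : {fun [set: 'cV[R]_s] >-> [set: 'cV[R]_s]}).
  exists q; split => //= -[Y Z] _ /=.
  rewrite /totalfun_ /G opprD addrACA subrr add0r -scalerBr -mulmxBr.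
  apply: mx_norm_le => [|i j]; first by rewrite mulr_ge0// mulr_ge0// mulr_ge0.
  rewrite (ord1 j) mxE normrM ger0_norm //.
  rewrite -[_ * K * L]mulrA -[leRHS]mulrA ler_wpM2l// -mulrA mxE.
  have -> : \sum_k A i k * (map2_mx f nd Y - map2_mx f nd Z) k 0 =
     \sum_k (row i A)^T k 0 * (f (nd k 0) (Y k 0) - f (nd k 0) (Z k 0)).
    by apply: eq_bigr => k _; rewrite !mxE.
  apply: weighted_sum_le => [||k]; [exact: AK|exact: mulr_ge0|].
  rewrite (le_trans (f_lip _ _ _))// ler_wpM2l//.
  by have := mx_entry_le_norm (Y - Z) k 0; rewrite !mxE.
have [||Y _ YG] := banach_fixed_point qG; first exact: closedT.
  by exists 0.
by exists Y.
Qed.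

Variables (c : 'cV[R]_s) (u : 'I_s -> R -> R) (a : R).

Lemma nodesE h i j : nodes c a h i j = a + h * c i 0.
Proof. by rewrite (ord1 j) !mxE. Qed.

(** The vectors [b] and [d] and every row of [A] are exact weights, each for its
    own remainder, so that all of them are covered by the results above. *)
Lemma frkn_coefficientsP h A (b d : 'cV[R]_s) :
  frkn_coefficients c u a h A b d <->
  [/\ exact_weights a c u (position_remainder a 1) 2 h b,
      exact_weights a c u (velocity_remainder a) 1 h d
    & forall i, exact_weights a c u (position_remainder a (c i 0)) 2 h (row i A)^T].
Proof.
have bE (w : 'cV[R]_s) k :
    (w^T *m map_mx (u k)^`(2)%classic (nodes c a h)) 0 0 =
    \sum_i w i 0 * (u k)^`(2)%classic (a + h * c i 0).
  by rewrite mxE; apply: eq_bigr => i _; rewrite !mxE.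
have AE k i : (A *m map_mx (u k)^`(2)%classic (nodes c a h)) i 0 =
    \sum_j (row i A)^T j 0 * (u k)^`(2)%classic (a + h * c j 0).
  by rewrite mxE; apply: eq_bigr => j _; rewrite !mxE.
have rhsE (x0 x1 : R) (P : 'cV[R]_s) i :
    (const_mx x0 + x1 *: c + h ^+ 2 *: P) i 0 = x0 + x1 * c i 0 + h ^+ 2 * P i 0.
  by rewrite !mxE.
split=> [H|[Hb Hd HA] k].
  split=> [k|k|i k]; have [Eb Ed EA] := H k.
  - by rewrite /position_remainder !mulr1 Eb bE; ring.
  - by rewrite /velocity_remainder Ed bE; ring.
  - have := congr1 (fun M : 'cV_s => M i 0) EA.
    rewrite [LHS]mxE nodesE rhsE AE => E.
    by rewrite /position_remainder E; ring.
split.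
- have := Hb k; rewrite /position_remainder !mulr1 -bE => <-; ring.
- have := Hd k; rewrite /velocity_remainder -bE expr1 => <-; ring.
- apply/colP => i; have := HA i k; rewrite /position_remainder -AE => E.
  by rewrite [LHS]mxE nodesE rhsE -E; ring.
Qed.

Hypothesis c_inj : injective (fun i => c i 0).
Hypothesis uC : forall k, Ck s.+2 (u k).
Hypothesis regular : \det (\matrix_(i < s, k < s) (u k)^`(i.+2)%classic a) != 0.
Hypothesis fC : Ck2 s (fun p => f p.1 p.2).

Lemma exact_solution_derives (y : R -> R) : exact_solution_near f a y ->
  derives_near a y y^`()%classic /\
  derives_near a y^`()%classic (fun t => f t (y t)).
Proof.
move=> sol; split; near=> t.
  have [dy _ _] : [/\ derivable y t 1, derivable (y^`()%classic) t 1
      & y^`(2)%classic t = f t (y t)] by near: t.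
  by apply: DeriveDef; rewrite ?derive1E.
have [_ dy1 y2] : [/\ derivable y t 1, derivable (y^`()%classic) t 1
    & y^`(2)%classic t = f t (y t)] by near: t.
by apply: DeriveDef; [exact: dy1|rewrite -derive1E; exact: y2].
Unshelve. all: by end_near. Qed.

Lemma frkn_step_exists h y0 y0' K : h != 0 -> collocF c u a h \in unitmx ->
  0 <= K -> (forall w i, exact_weights a c u (position_remainder a (c i 0)) 2 h w ->
    \sum_j `|w j 0| <= K) -> h ^+ 2 * K * L < 1 ->
  exists Y y1 y1', frkn_step c u f a h y0 y0' Y y1 y1'.
Proof.
move=> h0 Fu K0 HK hK.
have [b Hb] := exact_weights_exist (position_remainder a 1) 2 h0 Fu.
have [d Hd] := exact_weights_exist (velocity_remainder a) 1 h0 Fu.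
have /fin_all_exists[r Hr] (i : 'I_s) :=
  exact_weights_exist (position_remainder a (c i 0)) 2 h0 Fu.
pose A : 'M[R]_s := \matrix_(i, j) r i j 0.
have rA i : (row i A)^T = r i by apply/colP => j; rewrite !mxE.
have [|Y YE] := stage_equation_solvable (const_mx y0 + (h * y0') *: c)
    (nodes c a h) (A := A) K0 _ hK.
  by move=> i; rewrite rA; exact: HK (Hr i).
exists Y; do 2 eexists; exists A, b, d; split; last by split; [exact: YE| |].
by apply/frkn_coefficientsP; split => // i; rewrite rA.
Qed.

(** The stage error solves a linear inequality whose source is the consistency
    error of the rows of [A] and whose Lipschitz part carries a factor
    [h ^+ 2], so that it has the size of the source. *)
Lemma stage_error h A (y : R -> R) Y y0' K C : 0 <= h ->
  (forall i, \sum_j `|(row i A)^T j 0| <= K) -> h ^+ 2 * (s%:R * K) * L <= 2^-1 ->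
  (forall i, `|y (a + h * c i 0) - y a - h * c i 0 * y0' - h ^+ 2 *
      \sum_j (row i A)^T j 0 * f (a + h * c j 0) (y (a + h * c j 0))| <= C) ->
  Y = const_mx (y a) + (h * y0') *: c + h ^+ 2 *: (A *m map2_mx f (nodes c a h) Y) ->
  \sum_i `|Y i 0 - y (a + h * c i 0)| <= 2 * (s%:R * C).
Proof.
move=> h0 AK hK AC YE; set delta := \sum_i _.
have delta0 : 0 <= delta by exact: sumr_ge0.
have leD i : `|Y i 0 - y (a + h * c i 0)| <= delta.
  by rewrite /delta (bigD1 i)//= lerDl sumr_ge0.
have Yi i : `|Y i 0 - y (a + h * c i 0)| <= C + h ^+ 2 * (K * (L * delta)).
  pose g j := f (a + h * c j 0) (Y j 0) - f (a + h * c j 0) (y (a + h * c j 0)).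
  have -> : Y i 0 - y (a + h * c i 0) =
      h ^+ 2 * (\sum_j (row i A)^T j 0 * g j) -
      (y (a + h * c i 0) - y a - h * c i 0 * y0' - h ^+ 2 *
      \sum_j (row i A)^T j 0 * f (a + h * c j 0) (y (a + h * c j 0))).
    have -> : \sum_j (row i A)^T j 0 * g j =
        (A *m map2_mx f (nodes c a h) Y) i 0 -
        \sum_j (row i A)^T j 0 * f (a + h * c j 0) (y (a + h * c j 0)).
      rewrite mxE -sumrB; apply: eq_bigr => j _.
      by rewrite [map2_mx _ _ _ _ _]mxE nodesE !mxE /g; ring.
    rewrite {1}YE; set P := A *m _; rewrite !mxE; ring.
  rewrite addrC (le_trans (ler_normD _ _))// normrN lerD//.
  rewrite normrM ger0_norm ?sqr_ge0// ler_wpM2l ?sqr_ge0//.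
  apply: weighted_sum_le => // [|j]; first exact: mulr_ge0.
  by rewrite (le_trans (f_lip _ _ _))// ler_wpM2l.
have : delta <= \sum_(i < s) (C + h ^+ 2 * (K * (L * delta))).
  by apply: ler_sum => i _; exact: Yi.
rewrite sumr_const card_ord -[_ *+ s]mulr_natl => dle.
have := ler_wpM2r delta0 hK; move: dle; rewrite mulrDr.
set x := s%:R * _; set z := s%:R * (h ^+ 2 * _).
have -> : h ^+ 2 * (s%:R * K) * L * delta = z by rewrite /z; ring.
lra.
Qed.

(** Each component of the error splits into the consistency error of its weights
    on the exact solution and the effect of the stage error, which the Lipschitz
    condition bounds and which carries additional powers of [h].  The lowest
    order, [s.+1], comes from the consistency of the velocity weights. *)
Lemma frkn_local_error : local_error_exponents c u f a s s s.
Proof.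
move=> y /exact_solution_derives[dy dy1].
set y1 := y^`()%classic in dy dy1 *.
have sy2 := smooth_ode fC dy dy1.
have remP g := @position_remainder_operator R s a g.
have remV := @velocity_remainder_operator R s a.
have weights rem m (remm : remainder_operator s a rem m) :=
  exact_weights_bounded c_inj uC regular remm.
have consistent rem m (remm : remainder_operator s a rem m) :=
  exact_weights_consistent c_inj uC regular remm dy dy1 sy2.
have [Kb Kb0 HKb] := weights _ _ (remP 1).
have [Cb Cb0 HCb] := consistent _ _ (remP 1).
have [Kd Kd0 HKd] := weights _ _ remV.
have [Cd Cd0 HCd] := consistent _ _ remV.
have /fin_all_exists2[KA KA0 HKA] (i : 'I_s) := weights _ _ (remP (c i 0)).
have /fin_all_exists2[CA CA0 HCA] (i : 'I_s) := consistent _ _ (remP (c i 0)).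
pose K := \sum_i KA i; pose C := \sum_i CA i.
have K0 : 0 <= K by exact: sumr_ge0.
have C0 : 0 <= C by exact: sumr_ge0.
pose S := 2 * (s%:R * C).
have S0 : 0 <= S by rewrite mulr_ge0// mulr_ge0.
pose tot := Cb + Cd + S + (Kb + Kd) * (L * S).
exists tot; near=> h.
have h0 : 0 < h by [].
have h1 : h <= 1 by near: h; exact: nbhs_right_le.
(* The factor [s.+1] bounds both [1], for the contraction, and [s], for the
   sum over the stages in the error estimate. *)
have hKs : h ^+ 2 * (s.+1%:R * K) * L <= 2^-1.
  have : h < 2^-1 / (1 + s.+1%:R * K * L).
    by near: h; apply: nbhs_right_lt; rewrite divr_gt0// ltr_pwDl// !mulr_ge0.
  rewrite ltr_pdivlMr ?ltr_pwDl ?mulr_ge0// => /ltW; apply: le_trans.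
  rewrite -mulrA expr2 -mulrA ler_wpM2l ?(ltW h0)//.
  rewrite (@le_trans _ _ (s.+1%:R * K * L))//; last by rewrite lerDr.
  by rewrite ler_piMl ?mulr_ge0.
have hK1 : h ^+ 2 * K * L < 1.
  apply: (@le_lt_trans _ _ 2^-1); last by rewrite invf_lt1// ltr1n.
  apply: le_trans hKs; rewrite ler_wpM2r// ler_wpM2l ?sqr_ge0//.
  by rewrite ler_peMl// ler1n.
have hKss : h ^+ 2 * (s%:R * K) * L <= 2^-1.
  apply: le_trans hKs; rewrite ler_wpM2r// ler_wpM2l ?sqr_ge0//.
  by rewrite ler_wpM2r// ler_nat.
have KAh w i : exact_weights a c u (position_remainder a (c i 0)) 2 h w ->
    \sum_j `|w j 0| <= K.
  move=> wE; apply: (@le_trans _ _ (KA i)).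
    by move: w wE; move: i; near: h; exact: filter_forall.
  by rewrite /K (bigD1 i)//= lerDl sumr_ge0.
have CAh w i : exact_weights a c u (position_remainder a (c i 0)) 2 h w ->
    `|position_remainder a (c i 0) y y1 h - h ^+ 2 *
      \sum_j w j 0 * f (a + h * c j 0) (y (a + h * c j 0))| <= C * h ^+ (s + 2).
  move=> wE; apply: (@le_trans _ _ (CA i * h ^+ (s + 2))).
    by move: w wE; move: i; near: h; exact: filter_forall.
  by rewrite ler_wpM2r ?exprn_ge0 ?(ltW h0)// /C (bigD1 i)//= lerDl sumr_ge0.
split.
  apply: (frkn_step_exists _ _ (lt0r_neq0 h0) _ K0 KAh hK1).
  near: h; exact: collocF_unit_near c_inj uC regular.
move=> Y z1 z1' [A [b [d [/frkn_coefficientsP[Hb Hd HA]]]]].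
have Kbh : \sum_i `|b i 0| <= Kb by move: b Hb {HA Hd}; near: h.
have Kdh : \sum_i `|d i 0| <= Kd by move: d Hd {HA Hb}; near: h.
have Cbh : `|position_remainder a 1 y y1 h - h ^+ 2 *
    \sum_i b i 0 * f (a + h * c i 0) (y (a + h * c i 0))| <= Cb * h ^+ (s + 2).
  by move: b Hb {HA Hd Kbh}; near: h.
have Cdh : `|velocity_remainder a y y1 h - h ^+ 1 *
    \sum_i d i 0 * f (a + h * c i 0) (y (a + h * c i 0))| <= Cd * h ^+ (s + 1).
  by move: d Hd {HA Hb Kdh}; near: h.
move=> [YE -> ->].
have := stage_error (ltW h0) (fun i => KAh _ i (HA i)) hKss
  (fun i => CAh _ i (HA i)) YE.
rewrite !mulrA -[2 * _ * C]mulrA -/S => Yh.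
have hs2 : h ^+ (s + 2) <= h ^+ s.+1.
  by rewrite ler_wiXn2l ?(ltW h0)// addn2.
have hs1 : 0 <= h ^+ s.+1 by rewrite exprn_ge0 ?(ltW h0).
pose g j := f (a + h * c j 0) (Y j 0) - f (a + h * c j 0) (y (a + h * c j 0)).
have gh i : `|g i| <= L * (S * h ^+ s.+1).
  rewrite (le_trans (f_lip _ _ _))// ler_wpM2l//.
  apply: le_trans (ler_wpM2l S0 hs2); apply: le_trans Yh.
  by rewrite (bigD1 i)//= lerDl sumr_ge0.
have LS0 : 0 <= L * (S * h ^+ s.+1) by rewrite mulr_ge0// mulr_ge0.
have split_sum (w : 'cV[R]_s) :
    (w^T *m map2_mx f (nodes c a h) Y) 0 0 = \sum_i w i 0 * g i +
      \sum_i w i 0 * f (a + h * c i 0) (y (a + h * c i 0)).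
  rewrite mxE -big_split/=; apply: eq_bigr => i _.
  by rewrite [map2_mx _ _ _ _ _]mxE nodesE !mxE /g; ring.
have [tot1 tot2 tot3] : [/\ Cb + Kb * (L * S) <= tot,
    Cd + Kd * (L * S) <= tot & S <= tot].
  rewrite /tot mulrDl.
  have : 0 <= Kb * (L * S) /\ 0 <= Kd * (L * S) by split; rewrite !mulr_ge0.
  move: (Kb * (L * S)) (Kd * (L * S)) Cb0 Cd0 S0.
  by clear => p q Cb0 Cd0 S0 [p0 q0]; split; lra.
have bg := weighted_sum_le Kbh LS0 gh; have dg := weighted_sum_le Kdh LS0 gh.
split.
- rewrite split_sum.
  have -> : y (a + h) - (y a + h * y1 a + h ^+ 2 * (\sum_i b i 0 * g i +
      \sum_i b i 0 * f (a + h * c i 0) (y (a + h * c i 0)))) =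
    (position_remainder a 1 y y1 h - h ^+ 2 *
      \sum_i b i 0 * f (a + h * c i 0) (y (a + h * c i 0))) -
    h ^+ 2 * \sum_i b i 0 * g i.
    by rewrite /position_remainder !mulr1; ring.
  rewrite (le_trans (ler_normB _ _))//.
  apply: le_trans (ler_wpM2r hs1 tot1); rewrite mulrDl lerD//.
    exact: le_trans Cbh (ler_wpM2l Cb0 hs2).
  rewrite normrM ger0_norm ?sqr_ge0//.
  have -> : Kb * (L * S) * h ^+ s.+1 = Kb * (L * (S * h ^+ s.+1)) by ring.
  by apply: le_trans bg; rewrite ler_piMl// expr_le1// (ltW h0).
- rewrite split_sum.
  have -> : y1 (a + h) - (y1 a + h * (\sum_i d i 0 * g i +
      \sum_i d i 0 * f (a + h * c i 0) (y (a + h * c i 0)))) =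
    (velocity_remainder a y y1 h - h ^+ 1 *
      \sum_i d i 0 * f (a + h * c i 0) (y (a + h * c i 0))) -
    h * \sum_i d i 0 * g i.
    by rewrite /velocity_remainder expr1; ring.
  rewrite (le_trans (ler_normB _ _))//.
  rewrite addn1 in Cdh.
  apply: le_trans (ler_wpM2r hs1 tot2); rewrite mulrDl lerD//.
  rewrite normrM (gtr0_norm h0).
  have -> : Kd * (L * S) * h ^+ s.+1 = Kd * (L * (S * h ^+ s.+1)) by ring.
  by apply: le_trans dg; rewrite ler_piMl.
- move=> i; rewrite nodesE; apply: le_trans (ler_wpM2r hs1 tot3).
  apply: le_trans (ler_wpM2l S0 hs2); apply: le_trans Yh.
  by rewrite (bigD1 i)//= lerDl sumr_ge0.
Unshelve. all: by end_near. Qed.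

End LocalError.

(** * Order and stage order *)

Unset Implicit Arguments.

Theorem theorem4p4 (R : realType) (s : nat) (c : 'cV[R]_s) (t0 T : R)
    (u : 'I_s -> R -> R) (f : R -> R -> R) :
  (0 < s)%N ->
  injective (fun i => c i 0) ->
  0 < T ->
  (forall k, Ck s.+2 (u k)) ->
  linearly_independent u ->
  (forall k, u k <> cst 1 /\ u k <> id) ->
  collocation_condition c u t0 T ->
  Ck2 s (fun p : R * R => f p.1 p.2) ->
  (exists L : R, forall t, L.-lipschitz (f t)) ->
  [/\ [set t | t0 <= t <= t0 + T] `<=` closure (regular_points u t0 T),
      order_of_accuracy c u f (regular_points u t0 T) s
    & stage_order c u f (regular_points u t0 T) s].
Proof.
move=> _ c_inj T0 uC _ _ colloc fC [L f_lip].
(* The given constant may be negative. *)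
have lip t p q : `|f t p - f t q| <= `|L| * `|p - q|.
  have := f_lip t (p, q) (conj I I) => /le_trans; apply.
  by rewrite ler_wpM2r// ler_norm.
have err tn : regular_points u t0 T tn -> local_error_exponents c u f tn s s s.
  by move=> [_ regular]; exact: (frkn_local_error (normr_ge0 L) lip c_inj uC regular fC).
split; first exact: (regular_points_dense T0 uC colloc).
- by exists s, s, s; split; [rewrite minnn|exact: err].
- by exists s, s, s; split; [rewrite !minnn|exact: err].
Qed.
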